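(* For all $n\in\mathbb{N}$: $\mathrm{LPO}^{(n)}\not\le_W\widehat{\mathrm{LLPO}}^{(n)}$.
   Context: A representation of a set $X$ is a surjective partial function $\delta:\subseteq\mathbb{N}^\mathbb{N}\to X$; Baire space is represented by the identity and $\mathbb{N}$ by $p\mapsto p(0)$. For $f:\subseteq(X,\delta_X)\rightrightarrows(Y,\delta_Y)$ a realizer is a single-valued partial $F$ on Baire space with $\delta_Y(F(p))\in f(\delta_X(p))$ for all $p\in\mathrm{dom}(f\circ\delta_X)$ ($F\vdash f$). With $\langle p,q\rangle(2n)=p(n)$, $\langle p,q\rangle(2n+1)=q(n)$: $f\le_W g$ iff there are computable partial $H,K$ on Baire space such that $p\mapsto H\langle p,G(K(p))\rangle$ realizes $f$ for every $G\vdash g$. $\mathrm{LPO}:\mathbb{N}^\mathbb{N}\to\mathbb{N}$, $\mathrm{LPO}(p)=0$ if $p(n)=0$ for some $n$, and $1$ otherwise. $\mathrm{LLPO}:\subseteq\mathbb{N}^\mathbb{N}\rightrightarrows\mathbb{N}$ has domain $\{p:p(k)\neq0$ for at most one $k\}$, with $0\in\mathrm{LLPO}(p)$ iff $p(2n)=0$ for all $n$ and $1\in\mathrm{LLPO}(p)$ iff $p(2n+1)=0$ for all $n$. The parallelization $\widehat f:\subseteq X^\mathbb{N}\rightrightarrows Y^\mathbb{N}$ of $f$ is $\widehat f(x_i)_i=\prod_if(x_i)$, where sequence spaces are represented by $\langle p_0,p_1,\ldots\rangle\mapsto(\delta(p_i))_i$ with $\langle p_0,p_1,\ldots\rangle(\langle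 i,j\rangle)=p_i(j)$ for a standard pairing. $\lim:\subseteq\mathbb{N}^\mathbb{N}\to\mathbb{N}^\mathbb{N}$ maps $\langle p_0,p_1,\ldots\rangle$ to $\lim_ip_i$ whenever it exists. The derivative $f'$ of $f:\subseteq(X,\delta)\rightrightarrows Y$ is the same function with input representation $\delta\circ\lim$; $f^{(0)}=f$, $f^{(n+1)}=(f^{(n)})'$. $\widehat{\mathrm{LLPO}}^{(n)}$ denotes the $n$-th derivative of $\widehat{\mathrm{LLPO}}$. *)

(* Defs.v *)
From Stdlib Require Import Arith Lia List Cantor ClassicalEpsilon FunctionalExtensionality.
Import ListNotations.

(** ** Partial functions and Baire space *)

Record pfun (A B : Type) : Type := PFun {
  graph :> A -> B -> Prop;
  graph_functional : forall a b b', graph a b -> graph a b' -> b = b'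
}.
Arguments PFun {A B} _ _.
Arguments graph {A B} _ _ _.
Arguments graph_functional {A B} _ _ _ _ _ _.

Definition pid (A : Type) : pfun A A.
Proof. refine (PFun (fun a b => a = b) _). congruence. Defined.

Definition pcomp {A B C : Type} (g : pfun B C) (f : pfun A B) : pfun A C.
Proof.
refine (PFun (fun a c => exists b, f a b /\ g b c) _).
intros a c c' [b [fab gbc]] [b' [fab' gbc']].
rewrite (graph_functional f _ _ _ fab' fab) in gbc'.
exact (graph_functional g _ _ _ gbc gbc').
Defined.

Definition baire : Type := nat -> nat.

(** [pair_baire p q] is <p,q>, with <p,q>(2n) = p(n) and <p,q>(2n+1) = q(n). *)
Definition pair_baire (p q : baire) : baire :=
  fun n => if Nat.even n then p (Nat.div2 n) else q (Nat.div2 n).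

(** If r = <p_0,p_1,...> then [column r i] is p_i.  The Cantor pairing
    function is a bijection, so every r is of this form. *)
Definition column (r : baire) (i : nat) : baire := fun j => r (to_nat (i, j)).

(** ** Computable partial functions on Baire space *)

(** Programs for the partial functions of finitely many natural numbers that
    are recursive in an oracle: mu-recursion with the oracle as an additional
    initial function.  Programs carry no arity; a program applied to an
    argument list that is too short has no value. *)
Inductive code : Type :=
| Zero : code
| Succ : code
| Proj : nat -> code
| Oracle : code
| Comp : code -> list code -> code
| PrimRec : code -> code -> code
| Mu : code -> code.

(** [eval o c xs y]: with oracle [o], the program [c] halts on the arguments
    [xs] with value [y].  In [eval_mu] the search succeeds at [n] only if the
    program has a nonzero value [S (k m)] at every [m < n]. *)
Inductive eval (o : baire) : code -> list nat -> nat -> Prop :=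
| eval_zero xs : eval o Zero xs 0
| eval_succ x xs : eval o Succ (x :: xs) (S x)
| eval_proj i xs y : nth_error xs i = Some y -> eval o (Proj i) xs y
| eval_oracle x xs : eval o Oracle (x :: xs) (o x)
| eval_comp c ds xs ys y :
    evals o ds xs ys -> eval o c ys y -> eval o (Comp c ds) xs y
| eval_rec0 c d xs y : eval o c xs y -> eval o (PrimRec c d) (0 :: xs) y
| eval_recS c d n xs r y :
    eval o (PrimRec c d) (n :: xs) r -> eval o d (n :: r :: xs) y ->
    eval o (PrimRec c d) (S n :: xs) y
| eval_mu c xs n (k : nat -> nat) :
    (forall m, m < n -> eval o c (m :: xs) (S (k m))) ->
    eval o c (n :: xs) 0 -> eval o (Mu c) xs n
with evals (o : baire) : list code -> list nat -> list nat -> Prop :=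
| evals_nil xs : evals o [] xs []
| evals_cons d ds xs y ys :
    eval o d xs y -> evals o ds xs ys -> evals o (d :: ds) xs (y :: ys).

(** One program computes, from p in dom F as oracle, all values F(p)(n);
    nothing is required of it outside dom F. *)
Definition computable (F : pfun baire baire) : Prop :=
  exists c : code, forall p q, F p q -> forall n, eval p c [n] (q n).

(** ** Represented spaces *)

Record repspace : Type := RepSpace {
  carrier :> Type;
  delta : pfun baire carrier;
  delta_surjective : forall x, exists p, delta p x
}.

Definition baire_space : repspace.
Proof. refine (RepSpace baire (pid baire) _). intros x; exists x; reflexivity. Defined.

Definition nat_rep : pfun baire nat.
Proof.
refine (PFun (fun p n => p 0 = n) _).
intros p m n <- <-; reflexivity.
Defined.

Definition nat_space : repspace.
Proof.
refine (RepSpace nat nat_rep _).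
intros x; exists (fun _ => x); reflexivity.
Defined.

Definition seq_rep (X : repspace) : pfun baire (nat -> X).
Proof.
refine (PFun (fun r xs => forall i, delta X (column r i) (xs i)) _).
intros r xs ys Hx Hy. apply functional_extensionality; intros i.
exact (graph_functional _ _ _ _ (Hx i) (Hy i)).
Defined.

Definition seq_space (X : repspace) : repspace.
Proof.
refine (RepSpace (nat -> X) (seq_rep X) _).
intros xs.
pose (p := fun i =>
  constructive_indefinite_description _ (delta_surjective X (xs i))).
exists (fun k => proj1_sig (p (fst (of_nat k))) (snd (of_nat k))).
intros i.
replace (column _ i) with (proj1_sig (p i)); [exact (proj2_sig (p i))|].
apply functional_extensionality; intros j.
unfold column; rewrite cancel_of_to; reflexivity.
Defined.

(** The partial map lim: <p_0,p_1,...> |-> lim_i p_i, with convergence in the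
    topology of Baire space, whose basic neighbourhoods of [q] are the sets of
    points agreeing with [q] below some [k]. *)
Definition lim : pfun baire baire.
Proof.
refine (PFun (fun r q => forall k, exists N, forall i, N <= i ->
                         forall j, j < k -> column r i j = q j) _).
intros r q q' Hq Hq'. apply functional_extensionality; intros j.
destruct (Hq (S j)) as [N HN], (Hq' (S j)) as [N' HN'].
rewrite <- (HN (N + N') ltac:(lia) j ltac:(lia)).
apply HN'; lia.
Defined.

(** The same set with the representation delta o lim. *)
Definition jump_space (X : repspace) : repspace.
Proof.
refine (RepSpace (carrier X) (pcomp (delta X) lim) _).
intros x. destruct (delta_surjective X x) as [p px].
exists (fun k => p (snd (of_nat k))), p. split; [|exact px].
intros k; exists 0; intros i _ j _.
unfold column; rewrite cancel_of_to; reflexivity.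
Defined.

(** ** Multi-valued functions, realizers and Weihrauch reducibility *)

(** [values f x y] is y in f(x). *)
Record problem : Type := Problem {
  source : repspace;
  target : repspace;
  values : source -> target -> Prop
}.

Definition in_dom (f : problem) (x : source f) : Prop := exists y, values f x y.

Definition realizes (F : pfun baire baire) (f : problem) : Prop :=
  forall p x, delta (source f) p x -> in_dom f x ->
  exists q y, F p q /\ delta (target f) q y /\ values f x y.

(** p |-> H<p, G(K(p))> *)
Definition reduction (H K G : pfun baire baire) : pfun baire baire.
Proof.
refine (PFun (fun p s => exists r, pcomp G K p r /\ H (pair_baire p r) s) _).
intros p s s' [r [Hr Hs]] [r' [Hr' Hs']].
rewrite (graph_functional _ _ _ _ Hr' Hr) in Hs'.
exact (graph_functional H _ _ _ Hs Hs').
Defined.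

Definition weihrauch_le (f g : problem) : Prop :=
  exists H K : pfun baire baire, computable H /\ computable K /\
    forall G : pfun baire baire, realizes G g -> realizes (reduction H K G) f.

Definition parallelization (f : problem) : problem :=
  Problem (seq_space (source f)) (seq_space (target f))
    (fun xs ys => forall i, values f (xs i) (ys i)).

Definition derivative (f : problem) : problem :=
  Problem (jump_space (source f)) (target f) (values f).

Fixpoint derivative_n (n : nat) (f : problem) : problem :=
  match n with
  | 0 => f
  | S m => derivative (derivative_n m f)
  end.

Definition LPO : problem :=
  Problem baire_space nat_space (fun p y =>
    ((exists n, p n = 0) /\ y = 0) \/ (~ (exists n, p n = 0) /\ y = 1)).

Definition LLPO : problem :=
  Problem baire_space nat_space (fun p y =>
    (forall k l, p k <> 0 -> p l <> 0 -> k = l) /\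
    ((y = 0 /\ forall n, p (2 * n) = 0) \/
     (y = 1 /\ forall n, p (2 * n + 1) = 0))).

(* Main.v *)
(** Write [limn n] for the [n]-fold iterate of [lim].  A reduction of LPO^(n) to
    the n-th derivative of parallelized LLPO gives, for [p] with [limn n p]
    defined, a point [q = limn n (K p)] whose solutions form a nonempty compact
    set of bit sequences, on all of which [H] returns the same answer.  By
    compactness the answer is a continuous function of [(p, q)], and hence "the
    answer at [p] is 1" agrees, on the domain of [limn n], with a boldface
    Sigma^0_{n+1} set [A].  Conversely every Sigma^0_{n+1} set [A] has a total
    strict contraction [g] of Baire space such that [limn n (g x)] always exists
    and contains a zero iff [x] is in [A].  At the fixed point [x = g x] the
    sequence [limn n x] has a zero iff the answer at [x] is 1, that is, iff
    [limn n x] has no zero. *)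

From Stdlib Require Import Arith Lia List Cantor ClassicalEpsilon FunctionalExtensionality.
Require Import Defs.
Import ListNotations.

(** * Contractions of Baire space and compactness of Cantor space *)

Lemma choice_fun {A B : Type} (R : A -> B -> Prop) :
  (forall a, exists b, R a b) -> exists f, forall a, R a (f a).
Proof.
intros h.
exists (fun a => proj1_sig (constructive_indefinite_description _ (h a))).
intros a; exact (proj2_sig (constructive_indefinite_description _ (h a))).
Qed.

Lemma uniform_bound (R : nat -> nat -> Prop) (k : nat) :
  (forall j, j < k -> exists N, forall i, N <= i -> R j i) ->
  exists N, forall i, N <= i -> forall j, j < k -> R j i.
Proof.
induction k as [|k IH]; intros h.
- exists 0; intros; lia.
- destruct IH as [N HN]; [intros j Hj; apply h; lia|].
  destruct (h k (Nat.lt_succ_diag_r k)) as [M HM].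
  exists (N + M); intros i Hi j Hj.
  destruct (Nat.eq_dec j k) as [->|]; [apply HM|apply HN]; lia.
Qed.

Lemma fst_of_nat_le (k : nat) : fst (of_nat k) <= k.
Proof.
pose proof (cancel_to_of k) as E. destruct (of_nat k) as [a b].
pose proof (to_nat_non_decreasing a b). simpl; lia.
Qed.

Definition agree {T : Type} (k : nat) (x y : nat -> T) : Prop :=
  forall j, j < k -> x j = y j.

Lemma agree_mono {T : Type} (k l : nat) (x y : nat -> T) :
  k <= l -> agree l x y -> agree k x y.
Proof. intros kl h j Hj; apply h; lia. Qed.

Lemma agree_sym {T : Type} (k : nat) (x y : nat -> T) : agree k x y -> agree k y x.
Proof. intros h j Hj; symmetry; auto. Qed.

Lemma agree_trans {T : Type} (k : nat) (x y z : nat -> T) :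
  agree k x y -> agree k y z -> agree k x z.
Proof. intros h h' j Hj; rewrite h; auto. Qed.

(** Entry [j] of the value may read only entries before [j]: this is Lipschitz constant 1/2 for the
    usual metric of Baire space. *)
Definition contraction (g : baire -> baire) : Prop :=
  forall x y j, agree j x y -> g x j = g y j.

(** Picard iteration from the zero sequence: each step settles one more entry, so entry [j] of the
    fixed point is read off iterate [S j]. *)
Lemma contraction_fixpoint (g : baire -> baire) :
  contraction g -> exists x, g x = x.
Proof.
intros hg.
pose (it := fix it k : baire := match k with 0 => fun _ => 0 | S k => g (it k) end).
assert (stable : forall k m, k <= m -> agree k (it k) (it m)).
{ induction k as [|k IH]; intros m Hm j Hj; [lia|].
  destruct m as [|m]; [lia|]; simpl. apply hg.
  apply agree_mono with k; [lia|]. apply IH; lia. }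
exists (fun j => it (S j) j). apply functional_extensionality; intros j.
simpl. apply hg. intros i Hi. apply (stable (S i) j); lia.
Qed.

(* Compactness of Cantor space, by following a branch along which no single
   [k] works. *)
Lemma cantor_uniform (good : nat -> (nat -> bool) -> Prop) :
  (forall k l s, k <= l -> good k s -> good l s) ->
  (forall s, exists k, forall s', agree k s s' -> good k s') ->
  exists k, forall s, good k s.
Proof.
intros mono loc. apply NNPP; intros none.
pose (bad := fun n (s : nat -> bool) => forall k, exists s', agree n s s' /\ ~ good k s').
assert (step : forall ns : nat * (nat -> bool), exists s',
  bad (fst ns) (snd ns) -> agree (fst ns) (snd ns) s' /\ bad (S (fst ns)) s').
{ intros [n s]; simpl.
  pose (ext := fun (b : bool) j => if j =? n then b else s j).
  assert (ext_agree : forall b, agree n s (ext b)).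
  { intros b j Hj; unfold ext. destruct (Nat.eqb_spec j n); [lia|reflexivity]. }
  destruct (classic (bad (S n) (ext true))) as [h1|h1].
  { exists (ext true); auto. }
  exists (ext false); intros hs; split; [auto|].
  intros k. apply not_all_ex_not in h1. destruct h1 as [k1 h1].
  (* On the [true] half [k1] works, hence [k + k1] too. A failure of [k + k1] therefore lies in the
     [false] half. *)
  destruct (hs (k + k1)) as [s' [Hs Hg]].
  destruct (s' n) eqn:E.
  - exfalso; apply h1. exists s'; split.
    + intros j Hj; unfold ext. destruct (Nat.eqb_spec j n) as [->|]; [auto|apply Hs; lia].
    + intros g; apply Hg; apply mono with k1; [lia|exact g].
  - exists s'; split.
    + intros j Hj; unfold ext. destruct (Nat.eqb_spec j n) as [->|]; [auto|apply Hs; lia].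
    + intros g; apply Hg; apply mono with k; [lia|exact g]. }
destruct (choice_fun _ step) as [nxt Hnxt].
pose (br := fix br n := match n with 0 => fun _ => true | S n => nxt (n, br n) end).
assert (br_bad : forall n, bad n (br n)).
{ induction n as [|n IH].
  - intros k. apply NNPP; intros h. apply none; exists k; intros s.
    apply NNPP; intros hs. apply h; exists s; split; [intros j Hj; lia|exact hs].
  - apply (Hnxt (n, br n)); exact IH. }
assert (br_agree : forall m n, n <= m -> agree n (br n) (br m)).
{ induction m as [|m IH]; intros n Hn.
  - replace n with 0 by lia. intros j Hj; lia.
  - destruct (Nat.eq_dec n (S m)) as [->|]; [intros j Hj; reflexivity|].
    apply agree_trans with (br m); [apply IH; lia|].
    apply agree_mono with m; [lia|]. apply (Hnxt (m, br m)); apply br_bad. }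
destruct (loc (fun j => br (S j) j)) as [k Hk].
destruct (br_bad k k) as [s' [Hs' Hg]].
apply Hg, Hk. apply agree_trans with (br k); [|exact Hs'].
intros j Hj. apply (br_agree k (S j)); lia.
Qed.

(** * Oracle computations *)

Scheme eval_mut := Minimality for eval Sort Prop
  with evals_mut := Minimality for evals Sort Prop.
Combined Scheme eval_evals_ind from eval_mut, evals_mut.

Lemma eval_evals_functional (o : baire) :
  (forall c xs y, eval o c xs y -> forall z, eval o c xs z -> y = z) /\
  (forall cs xs ys, evals o cs xs ys -> forall zs, evals o cs xs zs -> ys = zs).
Proof.
apply eval_evals_ind.
- intros xs z h; inversion h; reflexivity.
- intros x xs z h; inversion h; reflexivity.
- intros i xs y hy z h; inversion h; congruence.
- intros x xs z h; inversion h; reflexivity.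
- intros c ds xs ys y _ IHs _ IH z h. inversion h as [ | | | |c' ds' xs' ys' z' h1 h2| | | ]; subst.
  apply IH. rewrite (IHs _ h1). exact h2.
- intros c d xs y _ IH z h. inversion h; subst; auto.
- intros c d n xs r y _ IHr _ IHy z h. inversion h as [ | | | | | |c' d' n' xs' r' z' h1 h2| ]; subst.
  apply IHy. rewrite (IHr _ h1). exact h2.
- intros c xs n k hk IHk h0 IH0 z h. inversion h as [ | | | | | | |c' xs' n' k' h1 h2]; subst.
  destruct (Nat.lt_trichotomy n z) as [lt|[E|lt]]; [|exact E|].
  + discriminate (IH0 _ (h1 n lt)).
  + discriminate (IHk z lt _ h2).
- intros xs zs h; inversion h; reflexivity.
- intros d ds xs y ys _ IH _ IHs zs h. inversion h; subst. f_equal; auto.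
Qed.

Lemma eval_functional (o : baire) (c : code) (xs : list nat) (y z : nat) :
  eval o c xs y -> eval o c xs z -> y = z.
Proof. intros h; apply (proj1 (eval_evals_functional o) _ _ _ h). Qed.

Definition is_open (A : baire -> Prop) : Prop :=
  forall x, A x -> exists k, forall y, agree k x y -> A y.

(** A halting run asks finitely many oracle questions. A [Mu] search has finitely many subruns,
    whose uses [uniform_bound] combines. *)
Lemma eval_evals_use (o : baire) :
  (forall c xs y, eval o c xs y ->
    exists k, forall o', agree k o o' -> eval o' c xs y) /\
  (forall cs xs ys, evals o cs xs ys ->
    exists k, forall o', agree k o o' -> evals o' cs xs ys).
Proof.
apply eval_evals_ind.
- intros xs; exists 0; intros; constructor.
- intros x xs; exists 0; intros; constructor.
- intros i xs y h; exists 0; intros; constructor; exact h.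
- intros x xs; exists (S x); intros o' h. rewrite (h x) by lia. constructor.
- intros c ds xs ys y _ [k1 h1] _ [k2 h2]. exists (k1 + k2); intros o' h.
  apply eval_comp with ys; [apply h1|apply h2];
    apply agree_mono with (2 := h); lia.
- intros c d xs y _ [k h]. exists k; intros; apply eval_rec0; auto.
- intros c d n xs r y _ [k1 h1] _ [k2 h2]. exists (k1 + k2); intros o' h.
  apply eval_recS with r; [apply h1|apply h2];
    apply agree_mono with (2 := h); lia.
- intros c xs n f _ IH _ [k0 h0].
  destruct (uniform_bound (fun m k => forall o', agree k o o' ->
    eval o' c (m :: xs) (S (f m))) n) as [N HN].
  { intros m Hm. destruct (IH m Hm) as [k hk]. exists k; intros i Hi o' h.
    apply hk; apply agree_mono with (2 := h); exact Hi. }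
  exists (N + k0); intros o' h. apply eval_mu with f.
  + intros m Hm. apply (HN (N + k0)); [lia|exact Hm|exact h].
  + apply h0; apply agree_mono with (2 := h); lia.
- intros xs; exists 0; intros; constructor.
- intros d ds xs y ys _ [k1 h1] _ [k2 h2]. exists (k1 + k2); intros o' h.
  constructor; [apply h1|apply h2]; apply agree_mono with (2 := h); lia.
Qed.

Lemma eval_open (c : code) (xs : list nat) (y : nat) :
  is_open (fun o => eval o c xs y).
Proof. intros o h; exact (proj1 (eval_evals_use o) _ _ _ h). Qed.

(** * The finite Borel hierarchy *)

(* [Sig n] is the boldface class Sigma^0_{n+1}: indexing starts with the open
   sets at [n = 0]. *)
Fixpoint Sig (n : nat) (A : baire -> Prop) : Prop :=
  match n with
  | 0 => is_open A
  | S m => exists B : nat -> baire -> Prop,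
      (forall i, Sig m (B i)) /\ (forall x, A x <-> exists i, ~ B i x)
  end.

Lemma Sig_ext (n : nat) (A B : baire -> Prop) :
  (forall x, A x <-> B x) -> Sig n A -> Sig n B.
Proof.
destruct n as [|n]; simpl; intros AB.
- intros h x Bx. destruct (h x (proj2 (AB x) Bx)) as [k hk].
  exists k; intros y hy; apply AB; auto.
- intros [C [hC hA]]. exists C; split; [exact hC|].
  intros x; rewrite <- AB; apply hA.
Qed.

Lemma Sig_union (n : nat) (A : nat -> baire -> Prop) :
  (forall i, Sig n (A i)) -> Sig n (fun x => exists i, A i x).
Proof.
destruct n as [|n]; simpl; intros h.
- intros x [i Ax]. destruct (h i x Ax) as [k hk]. exists k; intros y hy; eauto.
- destruct (choice_fun _ h) as [B hB].
  exists (fun k => B (fst (of_nat k)) (snd (of_nat k))); split.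
  + intros k; apply hB.
  + intros x; split.
    * intros [i Ax]. apply hB in Ax. destruct Ax as [j hj].
      exists (to_nat (i, j)). rewrite cancel_of_to; exact hj.
    * intros [k hk]. exists (fst (of_nat k)). apply hB. eauto.
Qed.

Lemma Sig_or (n : nat) (A B : baire -> Prop) :
  Sig n A -> Sig n B -> Sig n (fun x => A x \/ B x).
Proof.
intros hA hB.
apply Sig_ext with (fun x => exists i, (match i with 0 => A | _ => B end) x).
- intros x; split.
  + intros [[|i] h]; auto.
  + intros [h|h]; [exists 0|exists 1]; exact h.
- apply Sig_union; intros [|i]; assumption.
Qed.

(** By De Morgan, the intersection of two unions of complements is the union, over pairs, of
    complements of [C i] or [D j]; [Sig_or] one level down suffices. *)
Lemma Sig_and (n : nat) (A B : baire -> Prop) :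
  Sig n A -> Sig n B -> Sig n (fun x => A x /\ B x).
Proof.
destruct n as [|n]; simpl.
- intros hA hB x [Ax Bx].
  destruct (hA x Ax) as [k hk], (hB x Bx) as [l hl].
  exists (k + l); intros y hy.
  split; [apply hk|apply hl]; apply agree_mono with (2 := hy); lia.
- intros [C [hC CA]] [D [hD DB]].
  exists (fun k x => C (fst (of_nat k)) x \/ D (snd (of_nat k)) x); split.
  + intros k; apply Sig_or; auto.
  + intros x; rewrite CA, DB; split.
    * intros [[i hi] [j hj]]. exists (to_nat (i, j)). rewrite cancel_of_to; simpl; tauto.
    * intros [k hk]; split; eexists; intros h; apply hk; [left|right]; exact h.
Qed.

Lemma Sig_clopen (n k : nat) (A : baire -> Prop) :
  (forall x y, agree k x y -> A x -> A y) -> Sig n A.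
Proof.
revert A; induction n as [|n IH]; simpl; intros A h.
- intros x Ax; exists k; intros y hy; eauto.
- exists (fun _ x => ~ A x); split.
  + intros _; apply IH. intros x y hxy nA Ay.
    apply nA; apply h with y; [apply agree_sym|]; assumption.
  + intros x; split; [intros Ax; exists 0; tauto|].
    intros [_ hx]; apply NNPP; exact hx.
Qed.

Lemma Sig_forall_lt (n m : nat) (A : nat -> baire -> Prop) :
  (forall j, Sig n (A j)) -> Sig n (fun x => forall j, j < m -> A j x).
Proof.
intros h. induction m as [|m IH].
- apply (Sig_clopen n 0). intros x y _ _ j Hj; lia.
- apply Sig_ext with (fun x => A m x /\ forall j, j < m -> A j x).
  + intros x; split.
    * intros [h1 h2] j Hj. destruct (Nat.eq_dec j m) as [->|]; [exact h1|apply h2; lia].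
    * intros h1; split; [apply h1; lia|]. intros j Hj; apply h1; lia.
  + apply Sig_and; auto.
Qed.

Lemma Sig_exists_list (n m : nat) (A : list nat -> baire -> Prop) :
  (forall v, Sig n (A v)) -> Sig n (fun x => exists v, length v = m /\ A v x).
Proof.
revert A; induction m as [|m IH]; intros A h.
- apply Sig_ext with (A []); [|apply h].
  intros x; split.
  + intros Ax; exists []; auto.
  + intros [[|a v] [E Ax]]; [exact Ax|discriminate].
- apply Sig_ext with (fun x => exists a v, length v = m /\ A (a :: v) x).
  + intros x; split.
    * intros [a [v [E Ax]]]; exists (a :: v); simpl; auto.
    * intros [[|a v] [E Ax]]; [discriminate|]. exists a, v; auto.
  + apply Sig_union; intros a. apply IH; auto.
Qed.

(** * Iterated limits *)

Fixpoint limn (n : nat) (p q : baire) : Prop :=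
  match n with
  | 0 => p = q
  | S m => exists r, limn m p r /\ lim r q
  end.

Lemma limn_functional (n : nat) (p q q' : baire) : limn n p q -> limn n p q' -> q = q'.
Proof.
revert q q'; induction n as [|n IH]; simpl; intros q q'; [congruence|].
intros [r [h1 h2]] [r' [h1' h2']]. rewrite (IH _ _ h1' h1) in h2'.
exact (graph_functional lim _ _ _ h2 h2').
Qed.

Lemma derivative_n_succ_r (n : nat) (f : problem) :
  derivative_n (S n) f = derivative_n n (derivative f).
Proof.
induction n as [|n IH]; [reflexivity|].
change (derivative (derivative_n (S n) f) = derivative (derivative_n n (derivative f))).
rewrite IH; reflexivity.
Qed.

(** This replaces the nested jump spaces by [limn]. The induction varies [f], so the new derivative
    has to be moved innermost. *)
Lemma realizes_derivative_n (n : nat) (f : problem) (F : pfun baire baire) :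
  realizes F (derivative_n n f) <->
  forall p q x, limn n p q -> delta (source f) q x -> in_dom f x ->
  exists r y, F p r /\ delta (target f) r y /\ values f x y.
Proof.
revert f; induction n as [|n IH]; intros f.
- simpl; unfold realizes; split.
  + intros h p q x <-; apply h.
  + intros h p x; apply h; reflexivity.
- rewrite derivative_n_succ_r, IH; split.
  + intros h p q x [r [h1 h2]] dx ix.
    apply (h p r x h1); [exists q; auto|exact ix].
  + intros h p r x h1 [q [h2 dx]] ix.
    apply (h p q x); [exists r; auto|exact dx|exact ix].
Qed.

(* Level [S n] does not mention [k]: an approximating sequence can be delayed at
   will, which is what makes [Lev_realize] produce contractions. *)
Fixpoint Lev (n k : nat) (b : baire -> nat) : Prop :=
  match n with
  | 0 => forall x y, agree k x y -> b x = b y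
  | S m => exists bt : nat -> baire -> nat,
      (forall t, Lev m t (bt t)) /\
      (forall x, exists N, forall t, N <= t -> bt t x = b x)
  end.

Lemma Lev_mono (n k l : nat) (b : baire -> nat) : k <= l -> Lev n k b -> Lev n l b.
Proof.
destruct n as [|n]; simpl; [|auto].
intros kl h x y hxy; apply h; apply agree_mono with l; assumption.
Qed.

Lemma Lev_const (n k a : nat) : Lev n k (fun _ => a).
Proof.
revert k; induction n as [|n IH]; simpl; intros k; [auto|].
exists (fun _ _ => a); split; [auto|]. intros x; exists 0; auto.
Qed.

Lemma Lev_op (op : nat -> nat -> nat) (n k : nat) (b c : baire -> nat) :
  Lev n k b -> Lev n k c -> Lev n k (fun x => op (b x) (c x)).
Proof.
revert k b c; induction n as [|n IH]; simpl; intros k b c.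
- intros hb hc x y h; rewrite (hb x y h), (hc x y h); reflexivity.
- intros [bt [hb lb]] [ct [hc lc]].
  exists (fun t x => op (bt t x) (ct t x)); split; [auto|].
  intros x. destruct (lb x) as [N HN], (lc x) as [M HM].
  exists (N + M); intros t Ht. rewrite HN, HM by lia; reflexivity.
Qed.

(** Stage [i] of the approximation to entry [j] is stored at position [to_nat (i, j)]. It has level
    index [i], at most that position, so after all limits are unfolded each entry depends only on
    earlier ones. *)
Lemma Lev_realize (n : nat) (F : baire -> baire) :
  (forall j, Lev n j (fun x => F x j)) ->
  exists g, contraction g /\ forall x, limn n (g x) (F x).
Proof.
revert F; induction n as [|n IH]; simpl; intros F h.
- exists F; split; [|reflexivity]. intros x y j; apply h.
- destruct (choice_fun _ h) as [bt hbt].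
  destruct (IH (fun x k => bt (snd (of_nat k)) (fst (of_nat k)) x)) as [g [hg lg]].
  { intros k. apply Lev_mono with (fst (of_nat k)); [apply fst_of_nat_le|]. apply hbt. }
  exists g; split; [exact hg|].
  intros x. eexists; split; [apply lg|].
  intros k. apply (uniform_bound (fun j i => column
    (fun k => bt (snd (of_nat k)) (fst (of_nat k)) x) i j = F x j)).
  intros j _. destruct (proj2 (hbt j) x) as [N HN].
  exists N; intros i Hi. unfold column; rewrite cancel_of_to; simpl; auto.
Qed.

Definition ind (A : baire -> Prop) (x : baire) : nat :=
  if excluded_middle_informative (A x) then 1 else 0.

Lemma ind_true (A : baire -> Prop) (x : baire) : A x -> ind A x = 1.
Proof. unfold ind; destruct excluded_middle_informative; tauto. Qed.

Lemma ind_false (A : baire -> Prop) (x : baire) : ~ A x -> ind A x = 0.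
Proof. unfold ind; destruct excluded_middle_informative; tauto. Qed.

(** An open [A] is the increasing union of these clopen sets. *)
Definition inner (A : baire -> Prop) (t : nat) (x : baire) : Prop :=
  forall y, agree t x y -> A y.

Lemma inner_agree (A : baire -> Prop) (t : nat) (x y : baire) :
  agree t x y -> inner A t x -> inner A t y.
Proof. intros h hx z hz; apply hx; apply agree_trans with y; assumption. Qed.

Lemma Lev_ind_inner (A : baire -> Prop) (t : nat) : Lev 0 t (ind (inner A t)).
Proof.
intros x y h. destruct (classic (inner A t x)) as [hx|hx].
- rewrite !ind_true; eauto using inner_agree.
- rewrite !ind_false; eauto using inner_agree, agree_sym.
Qed.

Lemma Sig_Lev (n k : nat) (A : baire -> Prop) : Sig n A -> Lev (S n) k (ind A).
Proof.
revert k A; induction n as [|n IH]; intros k A.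
- intros hA. exists (fun t => ind (inner A t)); split; [apply Lev_ind_inner|].
  intros x. destruct (classic (A x)) as [Ax|Ax].
  + destruct (hA x Ax) as [N HN]. exists N; intros t Ht.
    rewrite !ind_true; auto. intros y hy; apply HN; apply agree_mono with t; auto.
  + exists 0; intros t _. rewrite !ind_false; auto.
    intros h; apply Ax; apply h; intros j _; reflexivity.
- intros [B [hB AB]].
  (* The finite partial unions of the complements of the [B i] increase to [A]; [e t] is the
     indicator of the one with [i < t]. *)
  pose (e := fix e t (x : baire) : nat := match t with 0 => 0 | S t =>
    (fun a b => match a with 0 => 1 | _ => b end) (ind (B t) x) (e t x) end).
  exists e; split.
  + assert (he : forall t l, Lev (S n) l (e t)); [|auto].
    induction t as [|t IHt]; intros l; [exact (Lev_const (S n) l 0)|].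
    exact (Lev_op (fun a b => match a with 0 => 1 | _ => b end) (S n) l _ _
      (IH l _ (hB t)) (IHt l)).
  + intros x. destruct (classic (A x)) as [Ax|Ax].
    * destruct (proj1 (AB x) Ax) as [i hi]. exists (S i); intros t Ht.
      rewrite ind_true by exact Ax.
      induction t as [|t IHt]; [lia|]; simpl.
      destruct (Nat.eq_dec t i) as [->|]; [rewrite ind_false; auto|].
      rewrite IHt by lia. destruct (ind (B t) x); reflexivity.
    * exists 0; intros t _. rewrite ind_false by exact Ax.
      induction t as [|t IHt]; simpl; [reflexivity|].
      rewrite ind_true; [exact IHt|].
      apply NNPP; intros h; apply Ax; apply AB; eauto.
Qed.

(** [Sig_Lev] for [A] itself would cost one limit too many. The outermost union is instead absorbed
    by the search for a zero: entry [j] is the indicator of [B j], one class lower. For open [A],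
    entry [j] is zero iff the ball fixed by the first [j] entries lies in [A]. *)
Lemma Sig_realize (n : nat) (A : baire -> Prop) :
  Sig n A -> exists (g F : baire -> baire), contraction g /\
    forall x, limn n (g x) (F x) /\ ((exists j, F x j = 0) <-> A x).
Proof.
intros hA.
assert (h : exists F : baire -> baire, (forall j, Lev n j (fun x => F x j)) /\
  forall x, (exists j, F x j = 0) <-> A x).
{ destruct n as [|n].
  - exists (fun x j => 1 - ind (inner A j) x); split.
    + intros j. apply (Lev_op Nat.sub 0 j (fun _ => 1)); [apply Lev_const|].
      apply Lev_ind_inner.
    + intros x; split.
      * intros [j hj]. apply NNPP; intros Ax. rewrite ind_false in hj; [discriminate|].
        intros h; apply Ax; apply h; intros i _; reflexivity.
      * intros Ax. destruct (hA x Ax) as [k hk]. exists k.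
        rewrite ind_true; auto.
  - destruct hA as [B [hB AB]]. exists (fun x j => ind (B j) x); split.
    + intros j; apply Sig_Lev; auto.
    + intros x; rewrite AB; split; intros [j hj]; exists j.
      * intros h; rewrite ind_true in hj; [discriminate|exact h].
      * apply ind_false; exact hj. }
destruct h as [F [hF FA]]. destruct (Lev_realize n F hF) as [g [hg lg]].
exists g, F; auto.
Qed.

(** For a convergent sequence, the limit has value [v] at [j] iff from some [N] on no term has
    another value [w] there. This is a countable union of complements, so each limit raises the
    class by one. *)
Lemma Sig_limn_value (n : nat) (G : baire -> baire -> Prop) :
  (forall j v, exists C, Sig 0 C /\ forall p y, G p y -> (C p <-> y j = v)) ->
  forall j v, exists C, Sig n C /\
    forall p y q, G p y -> limn n y q -> (C p <-> q j = v).
Proof.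
intros h0; induction n as [|n IH]; intros j v.
- destruct (h0 j v) as [C [hC CG]]. exists C; split; [exact hC|].
  intros p y q hy <-; auto.
- assert (h : forall jv : nat * nat, exists C, Sig n C /\
    forall p y q, G p y -> limn n y q -> (C p <-> q (fst jv) = snd jv)).
  { intros jv; apply IH. }
  destruct (choice_fun _ h) as [C hC].
  exists (fun p => exists N, ~ exists i w, (N <= i /\ w <> v) /\ C (to_nat (i, j), w) p).
  split.
  + exists (fun N p => exists i w, (N <= i /\ w <> v) /\ C (to_nat (i, j), w) p).
    split; [|reflexivity]. intros N.
    apply Sig_union; intros i. apply Sig_union; intros w.
    apply Sig_and; [apply (Sig_clopen n 0); auto|apply hC].
  + intros p y q hy [r [hr hq]].
    assert (val : forall i w, C (to_nat (i, j), w) p <-> column r i j = w).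
    { intros i w; exact (proj2 (hC (to_nat (i, j), w)) p y r hy hr). }
    destruct (hq (S j)) as [M HM].
    split.
    * intros [N HN]. rewrite <- (HM (N + M)) by lia.
      apply NNPP; intros ne. apply HN. exists (N + M), (column r (N + M) j).
      split; [split; [lia|exact ne]|]. apply val; reflexivity.
    * intros E. exists M. intros [i [w [[hi hw] hc]]]. apply val in hc.
      apply hw. rewrite <- hc, <- E. apply HM; lia.
Qed.

(** An open condition is witnessed by a finite prefix [v] of [q]. It becomes a countable union of
    finite intersections of conditions on single entries, which stays in the class. *)
Lemma Sig_limn_open (n : nat) (G O : baire -> baire -> Prop) :
  (forall j v, exists C, Sig 0 C /\ forall p y, G p y -> (C p <-> y j = v)) ->
  (forall p q, O p q -> exists k, forall p' q', agree k p p' -> agree k q q' -> O p' q') ->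
  exists A, Sig n A /\ forall p y q, G p y -> limn n y q -> (A p <-> O p q).
Proof.
intros hG hO.
assert (h : forall jv : nat * nat, exists C, Sig n C /\
  forall p y q, G p y -> limn n y q -> (C p <-> q (fst jv) = snd jv)).
{ intros jv; apply Sig_limn_value; exact hG. }
destruct (choice_fun _ h) as [C hC].
exists (fun p => exists m v, length v = m /\
  ((forall p' q', agree m p p' -> agree m (fun j => nth j v 0) q' -> O p' q') /\
   forall j, j < m -> C (j, nth j v 0) p)).
split.
- apply Sig_union; intros m.
  apply (Sig_exists_list n m (fun v p =>
    (forall p' q', agree m p p' -> agree m (fun j => nth j v 0) q' -> O p' q') /\
    forall j, j < m -> C (j, nth j v 0) p)).
  intros v. apply Sig_and.
  + apply (Sig_clopen n m). intros x y hxy hx p' q' hp hq.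
    apply hx; [apply agree_trans with y|]; assumption.
  + apply Sig_forall_lt; intros j; apply hC.
- intros p y q hy hq; split.
  + intros [m [v [_ [h1 h2]]]]. apply h1; [intros j _; reflexivity|].
    intros j Hj. symmetry. apply (proj2 (hC (j, nth j v 0)) p y q hy hq); auto.
  + intros Opq. destruct (hO p q Opq) as [k hk].
    exists k, (map q (seq 0 k)).
    assert (E : forall j, j < k -> nth j (map q (seq 0 k)) 0 = q j).
    { intros j Hj. rewrite nth_indep with (d' := q 0) by (rewrite length_map, length_seq; lia).
      rewrite map_nth, seq_nth by lia. reflexivity. }
    split; [rewrite length_map, length_seq; reflexivity|]. split.
    * intros p' q' hp hq'. apply hk; [exact hp|].
      intros j Hj. rewrite <- E by exact Hj. apply hq'; exact Hj.
    * intros j Hj. apply (proj2 (hC (j, _)) p y q hy hq); simpl.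
      symmetry; apply E; exact Hj.
Qed.

(** * Compactness of the solution sets *)

(** A name of the bit sequence [s] with constant columns; position [k] reads a bit of index at most
    [k]. *)
Definition spread (s : nat -> bool) : baire :=
  fun k => if s (fst (of_nat k)) then 1 else 0.

(** A closed condition on [(q, s)] that describes the solutions whenever all columns of [q] lie in
    the domain of [LLPO]. *)
Definition selects (q : baire) (s : nat -> bool) : Prop :=
  forall i n, column q i (2 * n + (if s i then 1 else 0)) = 0.

(** Argument 0 because a number is named by entry 0; value 1 is the answer of [LPO] for no zero. *)
Definition forced (c : code) (p q : baire) : Prop :=
  forall s, selects q s -> eval (pair_baire p (spread s)) c [0] 1.

(** Near each [s] a finite prefix suffices: either [s] is a solution and the run has finite use, or
    one nonzero entry of [q] refutes [s]. Compactness makes the prefix length uniform. *)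
Lemma forced_open (c : code) (p q : baire) :
  forced c p q ->
  exists k, forall p' q', agree k p p' -> agree k q q' -> forced c p' q'.
Proof.
intros hpq.
destruct (cantor_uniform (fun k s => forall p' q', agree k p p' -> agree k q q' ->
  selects q' s -> eval (pair_baire p' (spread s)) c [0] 1)) as [k hk].
- intros k l s kl h p' q' hp hq. apply h; apply agree_mono with l; assumption.
- intros s. destruct (classic (selects q s)) as [hs|hs].
  + destruct (eval_open c [0] 1 _ (hpq s hs)) as [k hk].
    exists k; intros s' hs' p' q' hp _ _. apply hk.
    intros j Hj. pose proof (Nat.div2_decr j j (Nat.le_succ_diag_r j)) as D. unfold pair_baire.
    destruct (Nat.even j); [apply hp; lia|].
    pose proof (fst_of_nat_le (Nat.div2 j)). unfold spread. rewrite hs' by lia. reflexivity.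
  + apply not_all_ex_not in hs. destruct hs as [i hs].
    apply not_all_ex_not in hs. destruct hs as [n hs].
    set (m := to_nat (i, 2 * n + (if s i then 1 else 0))).
    (* The refutation depends on bit [i] of [s] and entry [m] of [q]. *)
    exists (S (i + m)); intros s' hs' p' q' _ hq sel. exfalso; apply hs.
    specialize (sel i n). rewrite <- (hs' i) in sel by lia.
    unfold column in *. fold m in sel |- *. rewrite (hq m) by lia. exact sel.
- exists k; intros p' q' hp hq s hs. apply (hk s p' q'); assumption.
Qed.

(** * Realizers of parallelized LLPO *)

Definition solution (n : nat) (y r : baire) : Prop :=
  exists q, limn n y q /\ forall i, values LLPO (column q i) (column r i 0).

(* Being undefined off the domain, such a realizer forces [K] to map valid
   inputs into the domain. *)
Definition selector (n : nat) (phi : baire -> baire) : pfun baire baire.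
Proof.
refine (PFun (fun y r => solution n y r /\ r = phi y) _).
intros y r r' [_ ->] [_ ->]; reflexivity.
Defined.

Lemma selector_realizes (n : nat) (phi : baire -> baire) :
  (forall y, (exists r, solution n y r) -> solution n y (phi y)) ->
  realizes (selector n phi) (derivative_n n (parallelization LLPO)).
Proof.
intros hphi. apply realizes_derivative_n. intros y q xs hq hxs [ys hys].
assert (sol : solution n y (phi y)).
{ apply hphi. exists (fun k => ys (fst (of_nat k))), q; split; [exact hq|].
  intros i. specialize (hxs i); simpl in hxs; rewrite hxs.
  unfold column; rewrite cancel_of_to. apply hys. }
exists (phi y), (fun i => column (phi y) i 0). split; [split; auto|].
split; [intros i; reflexivity|].
destruct sol as [q' [hq' hv]]. rewrite (limn_functional n y q' q hq' hq) in hv.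
intros i. specialize (hxs i); simpl in hxs; rewrite <- hxs. apply hv.
Qed.

(** * The diagonal argument *)

Theorem theorem12p2 (n : nat) :
  ~ weihrauch_le (derivative_n n LPO) (derivative_n n (parallelization LLPO)).
Proof.
intros [H [K [[cH hH] [[cK hK] red]]]].
destruct (Sig_limn_open n K (forced cH)) as [A [sA hA]].
{ intros j v. exists (fun p => eval p cK [j] v); split; [apply eval_open|].
  intros p y hy; split.
  - intros h. exact (eval_functional _ _ _ _ _ (hK p y hy j) h).
  - intros <-; apply hK; exact hy. }
{ apply forced_open. }
destruct (Sig_realize n A sA) as [g [F [hg hF]]].
destruct (contraction_fixpoint g hg) as [x hx].
destruct (hF x) as [lx FA]; rewrite hx in lx. clear hF hx hg g.
(* By [lx], [x] is a name of the input [F x]. The reduction is run on it with the realizer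
   [selector n phi]. *)
assert (run : forall phi,
  (forall y, (exists r, solution n y r) -> solution n y (phi y)) ->
  exists y a, K x y /\ solution n y (phi y) /\ values LPO (F x) a /\
    eval (pair_baire x (phi y)) cH [0] a).
{ intros phi hphi.
  pose proof (red _ (selector_realizes n phi hphi)) as R.
  rewrite realizes_derivative_n in R.
  destruct (R x (F x) (F x) lx eq_refl) as [s [a [[r [[y [hy [sol ->]]] hs]] [<- hv]]]].
  { destruct (classic (exists j, F x j = 0)) as [z|z]; [exists 0|exists 1]; simpl; auto. }
  exists y, (s 0). split; [exact hy|]. split; [exact sol|]. split; [exact hv|].
  apply hH; exact hs. }
destruct (choice_fun (fun y r => (exists r, solution n y r) -> solution n y r)) as [phi0 hphi0].
{ intros y. destruct (classic (exists r, solution n y r)) as [[r hr]|no];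
    [exists r; auto|exists y; tauto]. }
destruct (run phi0 hphi0) as [y [_ [hy [[q [hq sol]] _]]]].
specialize (hA x y q hy hq).
(* Every solution is returned by some realizer: redefine [phi0] at the single point [y]. Hence [H]
   answers correctly on all of them. *)
assert (answer : forall s, selects q s -> exists a, values LPO (F x) a /\
  eval (pair_baire x (spread s)) cH [0] a).
{ intros s hs.
  destruct (run (fun y' => if excluded_middle_informative (y' = y) then spread s else phi0 y'))
    as [y' [a [hy' [_ [ha he]]]]].
  - intros y' hy'. destruct excluded_middle_informative as [->|]; [|auto].
    exists q; split; [exact hq|]. intros i. split; [apply sol|].
    specialize (hs i). unfold column at 1 3; unfold spread; rewrite cancel_of_to; simpl fst.
    destruct (s i); [right|left]; split; auto.
    intros m. rewrite <- (Nat.add_0_r (2 * m)). apply hs.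
  - rewrite (graph_functional K _ _ _ hy' hy) in he.
    destruct excluded_middle_informative; [|congruence]. eauto. }
destruct (classic (exists j, F x j = 0)) as [z|z].
(* If [F x] has a zero, [A x] forces the answer 1 on every solution. The bits of [phi0 y] provide a
   solution, where the correct answer is 0. *)
- assert (hs : selects q (fun i => column (phi0 y) i 0 =? 1)).
  { intros i m. destruct (sol i) as [_ [[E hv]|[E hv]]]; rewrite E; simpl Nat.eqb; cbv iota.
    - rewrite Nat.add_0_r; apply hv.
    - apply hv. }
  destruct (answer _ hs) as [a [ha he]].
  pose proof (proj1 hA (proj1 FA z) _ hs) as he'.
  rewrite (eval_functional _ _ _ _ _ he he') in ha.
  destruct ha as [[_ E]|[nz _]]; [discriminate|tauto].
(* Without a zero all correct answers are 1, so [forced] holds, hence [A x], which yields a zero. *)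
- apply z, FA, hA. intros s hs. destruct (answer s hs) as [a [[[z' _]|[_ ->]] he]]; tauto.
Qed.
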